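(* Let $A$ and $B$ be diassociative algebras over a field $\mathbb{F}$ and let $(\varphi_{\dashv},\varphi_{\vdash},\varphi_{\dashv}',\varphi_{\vdash}',f_{\dashv},f_{\vdash})$ be a factor system of $A$ by $B$. The following are equivalent: (a) $(\varphi_{\dashv},\varphi_{\vdash},\varphi_{\dashv}',\varphi_{\vdash}',f_{\dashv},f_{\vdash})$ splits; (b) $(\varphi_{\dashv},\varphi_{\vdash},\varphi_{\dashv}',\varphi_{\vdash}',f_{\dashv},f_{\vdash})$ is equivalent to some factor system $(\psi_{\dashv},\psi_{\vdash},\psi_{\dashv}',\psi_{\vdash}',g_{\dashv},g_{\vdash})$ of $A$ by $B$ such that $g_{\dashv}=0$ and $g_{\vdash}=0$; (c) there exists a linear transformation $E:B\to A$ such that, for all $i,j\in B$, $$f_{\dashv}(i,j)=-\varphi_{\dashv}'(j)E(i)-\varphi_{\dashv}(i)E(j)-E(i)\dashv E(j)+E(i\dashv j),$$ $$f_{\vdash}(i,j)=-\varphi_{\vdash}'(j)E(i)-\varphi_{\vdash}(i)E(j)-E(i)\vdash E(j)+E(i\vdash j).$$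
   Context: All algebras are vector spaces over a fixed field $\mathbb{F}$. A diassociative algebra is a vector space with two associative bilinear products $\dashv,\vdash$ satisfying, for all $x,y,z$: (D1) $x\dashv(y\dashv z)=x\dashv(y\vdash z)$; (D2) $(x\vdash y)\dashv z=x\vdash(y\dashv z)$; (D3) $(x\dashv y)\vdash z=(x\vdash y)\vdash z$. Homomorphisms are linear maps preserving both products. $\mathcal{L}(A)$ is the space of linear maps $A\to A$. A factor system of $A$ by $B$ is a tuple $(\varphi_{\dashv},\varphi_{\vdash},\varphi_{\dashv}',\varphi_{\vdash}',f_{\dashv},f_{\vdash})$ with $\varphi_{\dashv},\varphi_{\vdash},\varphi_{\dashv}',\varphi_{\vdash}':B\to\mathcal{L}(A)$ linear and $f_{\dashv},f_{\vdash}:B\times B\to A$ bilinear such that for all $m,n,p\in A$, $i,j,k\in B$: 1. (a) $m\dashv(\varphi_{\dashv}(j)p)=m\dashv(\varphi_{\vdash}(j)p)$; (b) $m\dashv(\varphi_{\dashv}'(k)n)=m\dashv(\varphi_{\vdash}'(k)n)$; (c) $m\dashv f_{\dashv}(j,k)+\varphi_{\dashv}'(j\dashv k)m=m\dashv f_{\vdash}(j,k)+\varphi_{\dashv}'(j\vdash k)m$; (d) $\varphi_{\dashv}(i)(n\dashv p)=\varphi_{\dashv}(i)(n\vdash p)$; (e) $\varphi_{\dashv}(i)(\varphi_{\dashv}(j)p)=\varphi_{\dashv}(i)(\varphi_{\vdash}(j)p)$; (f) $\varphi_{\dashv}(i)(\varphi_{\dashv}'(k)n)=\varphi_{\dashv}(i)(\varphi_{\vdash}'(k)n)$;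 (g) $\varphi_{\dashv}(i)f_{\dashv}(j,k)+f_{\dashv}(i,j\dashv k)=\varphi_{\dashv}(i)f_{\vdash}(j,k)+f_{\dashv}(i,j\vdash k)$. 2. (a) $(\varphi_{\vdash}(i)n)\dashv p=\varphi_{\vdash}(i)(n\dashv p)$; (b) $(\varphi_{\vdash}'(j)m)\dashv p=m\vdash(\varphi_{\dashv}(j)p)$; (c) $f_{\vdash}(i,j)\dashv p+\varphi_{\dashv}(i\vdash j)p=\varphi_{\vdash}(i)(\varphi_{\dashv}(j)p)$; (d) $\varphi_{\dashv}'(k)(m\vdash n)=m\vdash(\varphi_{\dashv}'(k)n)$; (e) $\varphi_{\dashv}'(k)(\varphi_{\vdash}(i)n)=\varphi_{\vdash}(i)(\varphi_{\dashv}'(k)n)$; (f) $\varphi_{\dashv}'(k)(\varphi_{\vdash}'(j)m)=\varphi_{\vdash}'(j\dashv k)m+m\vdash f_{\dashv}(j,k)$; (g) $\varphi_{\dashv}'(k)f_{\vdash}(i,j)+f_{\dashv}(i\vdash j,k)=\varphi_{\vdash}(i)f_{\dashv}(j,k)+f_{\vdash}(i,j\dashv k)$. 3. (a) $(\varphi_{\dashv}(i)n)\vdash p=(\varphi_{\vdash}(i)n)\vdash p$; (b) $(\varphi_{\dashv}'(j)m)\vdash p=(\varphi_{\vdash}'(j)m)\vdash p$; (c) $f_{\dashv}(i,j)\vdash p+\varphi_{\vdash}(i\dashv j)p=f_{\vdash}(i,j)\vdash p+\varphi_{\vdash}(i\vdash j)p$; (d) $\varphi_{\vdash}'(k)(m\dashv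 n)=\varphi_{\vdash}'(k)(m\vdash n)$; (e) $\varphi_{\vdash}'(k)(\varphi_{\dashv}(i)n)=\varphi_{\vdash}'(k)(\varphi_{\vdash}(i)n)$; (f) $\varphi_{\vdash}'(k)(\varphi_{\dashv}'(j)m)=\varphi_{\vdash}'(k)(\varphi_{\vdash}'(j)m)$; (g) $\varphi_{\vdash}'(k)f_{\dashv}(i,j)+f_{\vdash}(i\dashv j,k)=\varphi_{\vdash}'(k)f_{\vdash}(i,j)+f_{\vdash}(i\vdash j,k)$. 4. (a) $m\dashv(\varphi_{\dashv}(j)p)=(\varphi_{\dashv}'(j)m)\dashv p$; (b) $m\dashv(\varphi_{\dashv}'(k)n)=\varphi_{\dashv}'(k)(m\dashv n)$; (c) $m\dashv f_{\dashv}(j,k)+\varphi_{\dashv}'(j\dashv k)m=\varphi_{\dashv}'(k)(\varphi_{\dashv}'(j)m)$; (d) $\varphi_{\dashv}(i)(n\dashv p)=(\varphi_{\dashv}(i)n)\dashv p$; (e) $\varphi_{\dashv}(i)(\varphi_{\dashv}(j)p)=\varphi_{\dashv}(i\dashv j)p+f_{\dashv}(i,j)\dashv p$; (f) $\varphi_{\dashv}(i)(\varphi_{\dashv}'(k)n)=\varphi_{\dashv}'(k)(\varphi_{\dashv}(i)n)$; (g) $\varphi_{\dashv}(i)f_{\dashv}(j,k)+f_{\dashv}(i,j\dashv k)=\varphi_{\dashv}'(k)f_{\dashv}(i,j)+f_{\dashv}(i\dashv j,k)$. 5. The identities obtained from 4(a)–(g) by replacing every $\dashv$ (including in subscripts)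 by $\vdash$. An extension of $A$ by $B$ is a short exact sequence $0\to A\xrightarrow{\sigma}L\xrightarrow{\pi}B\to0$ with $L$ a diassociative algebra and $\sigma,\pi$ homomorphisms. A section is a linear map $T:B\to L$ with $\pi T=I_B$. The extension splits if some section is a homomorphism. For $x\in L$, $m\in A$ put $P_{\dashv}(x)m=\sigma^{-1}(x\dashv\sigma(m))$, $P_{\dashv}'(x)m=\sigma^{-1}(\sigma(m)\dashv x)$, $P_{\vdash}(x)m=\sigma^{-1}(x\vdash\sigma(m))$, $P_{\vdash}'(x)m=\sigma^{-1}(\sigma(m)\vdash x)$. A factor system belongs to the extension and $T$ if $\varphi_{\dashv}=P_{\dashv}T$, $\varphi_{\vdash}=P_{\vdash}T$, $\varphi_{\dashv}'=P_{\dashv}'T$, $\varphi_{\vdash}'=P_{\vdash}'T$, $\sigma(f_{\dashv}(i,j))=T(i)\dashv T(j)-T(i\dashv j)$ and $\sigma(f_{\vdash}(i,j))=T(i)\vdash T(j)-T(i\vdash j)$ for all $i,j\in B$. Every factor system belongs to an extension (and section), and any two extensions to which it belongs are equivalent, i.e. related by an isomorphism $\tau$ of the middle terms with $\tau\sigma_1=\sigma_2$, $\pi_2\tau=\pi_1$; a factor system splits if the corresponding extension splits. Factor systems $(\varphi_{\dashv},\varphi_{\vdash},\varphi_{\dashv}',\varphi_{\vdash}',f_{\dashv},f_{\vdash})$ and $(\psi_{\dashv},\psi_{\vdash},\psi_{\dashv}',\psi_{\vdash}',g_{\dashv},g_{\vdash})$ are equivalent if there is a linear map $E:B\to A$ such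 that for each $*\in\{\dashv,\vdash\}$ and all $i,j\in B$, $m\in A$: $\psi_*(i)m=\varphi_*(i)m+E(i)*m$; $\psi_*'(i)m=\varphi_*'(i)m+m*E(i)$; $g_*(i,j)=f_*(i,j)+\varphi_*'(j)E(i)+\varphi_*(i)E(j)+E(i)*E(j)-E(i*j)$. *)

(* Defs.v *)
From HB Require Import structures.
From mathcomp Require Import all_boot all_algebra.

Set Implicit Arguments.
Unset Strict Implicit.
Unset Printing Implicit Defensive.

Import GRing.Theory.
Local Open Scope ring_scope.

Declare Scope diass_scope.

(* dashv and vdash are named after the LaTeX commands for the two products,
   written ⊣ and ⊢ below. *)
HB.mixin Record Lmodule_isDiassociative (F : fieldType) A
    of GRing.Lmodule F A := {
  dashv : A -> A -> A;
  vdash : A -> A -> A;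
  dashv_bilinear : bilinear_for *:%R *:%R dashv;
  vdash_bilinear : bilinear_for *:%R *:%R vdash;
  dashvA : associative dashv;
  vdashA : associative vdash;
  diassD1 : forall x y z, dashv x (dashv y z) = dashv x (vdash y z);
  diassD2 : forall x y z, dashv (vdash x y) z = vdash x (dashv y z);
  diassD3 : forall x y z, vdash (dashv x y) z = vdash (vdash x y) z
}.

#[short(type="diassType")]
HB.structure Definition Diassociative (F : fieldType) :=
  {A of GRing.Lmodule F A & Lmodule_isDiassociative F A}.

Notation "x ⊣ y" := (dashv x y)
  (at level 40, left associativity) : diass_scope.
Notation "x ⊢ y" := (vdash x y)
  (at level 40, left associativity) : diass_scope.
Open Scope diass_scope.

HB.instance Definition _ (F : fieldType) (A : diassType F) :=
  bilinear_isBilinear.Build F A A A *:%R *:%R (@dashv F A) dashv_bilinear.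
HB.instance Definition _ (F : fieldType) (A : diassType F) :=
  bilinear_isBilinear.Build F A A A *:%R *:%R (@vdash F A) vdash_bilinear.

Definition diass_hom (F : fieldType) (A B : diassType F) (h : A -> B) : Prop :=
  (forall x y, h (x ⊣ y) = h x ⊣ h y) /\ (forall x y, h (x ⊢ y) = h x ⊢ h y).

(* A linear map from B to the space of linear endomorphisms of A is given in
   curried form, as a bilinear map B -> A -> A. *)
Record factor_data (F : fieldType) (A B : diassType F) := FactorData {
  phi_dashv  : {bilinear B -> A -> A};
  phi_vdash  : {bilinear B -> A -> A};
  phi'_dashv : {bilinear B -> A -> A};
  phi'_vdash : {bilinear B -> A -> A};
  f_dashv    : {bilinear B -> B -> A};
  f_vdash    : {bilinear B -> B -> A}
}.

Section FactorAxioms.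
Variables (F : fieldType) (A B : diassType F) (D : factor_data A B).

Local Notation "φ⊣" := (phi_dashv D).
Local Notation "φ⊢" := (phi_vdash D).
Local Notation "φ'⊣" := (phi'_dashv D).
Local Notation "φ'⊢" := (phi'_vdash D).
Local Notation "f⊣" := (f_dashv D).
Local Notation "f⊢" := (f_vdash D).

Implicit Types (m n p : A) (i j k : B).

Record factor_axioms1 : Prop := FactorAxioms1 {
  fs1a m j p : m ⊣ φ⊣ j p = m ⊣ φ⊢ j p;
  fs1b m k n : m ⊣ φ'⊣ k n = m ⊣ φ'⊢ k n;
  fs1c m j k : m ⊣ f⊣ j k + φ'⊣ (j ⊣ k) m = m ⊣ f⊢ j k + φ'⊣ (j ⊢ k) m;
  fs1d i n p : φ⊣ i (n ⊣ p) = φ⊣ i (n ⊢ p);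
  fs1e i j p : φ⊣ i (φ⊣ j p) = φ⊣ i (φ⊢ j p);
  fs1f i k n : φ⊣ i (φ'⊣ k n) = φ⊣ i (φ'⊢ k n);
  fs1g i j k : φ⊣ i (f⊣ j k) + f⊣ i (j ⊣ k) = φ⊣ i (f⊢ j k) + f⊣ i (j ⊢ k)
}.

Record factor_axioms2 : Prop := FactorAxioms2 {
  fs2a i n p : φ⊢ i n ⊣ p = φ⊢ i (n ⊣ p);
  fs2b j m p : φ'⊢ j m ⊣ p = m ⊢ φ⊣ j p;
  fs2c i j p : f⊢ i j ⊣ p + φ⊣ (i ⊢ j) p = φ⊢ i (φ⊣ j p);
  fs2d k m n : φ'⊣ k (m ⊢ n) = m ⊢ φ'⊣ k n;
  fs2e k i n : φ'⊣ k (φ⊢ i n) = φ⊢ i (φ'⊣ k n);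
  fs2f k j m : φ'⊣ k (φ'⊢ j m) = φ'⊢ (j ⊣ k) m + m ⊢ f⊣ j k;
  fs2g i j k : φ'⊣ k (f⊢ i j) + f⊣ (i ⊢ j) k = φ⊢ i (f⊣ j k) + f⊢ i (j ⊣ k)
}.

Record factor_axioms3 : Prop := FactorAxioms3 {
  fs3a i n p : φ⊣ i n ⊢ p = φ⊢ i n ⊢ p;
  fs3b j m p : φ'⊣ j m ⊢ p = φ'⊢ j m ⊢ p;
  fs3c i j p : f⊣ i j ⊢ p + φ⊢ (i ⊣ j) p = f⊢ i j ⊢ p + φ⊢ (i ⊢ j) p;
  fs3d k m n : φ'⊢ k (m ⊣ n) = φ'⊢ k (m ⊢ n);
  fs3e k i n : φ'⊢ k (φ⊣ i n) = φ'⊢ k (φ⊢ i n);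
  fs3f k j m : φ'⊢ k (φ'⊣ j m) = φ'⊢ k (φ'⊢ j m);
  fs3g i j k : φ'⊢ k (f⊣ i j) + f⊢ (i ⊣ j) k = φ'⊢ k (f⊢ i j) + f⊢ (i ⊢ j) k
}.

Record factor_axioms4 : Prop := FactorAxioms4 {
  fs4a m j p : m ⊣ φ⊣ j p = φ'⊣ j m ⊣ p;
  fs4b m k n : m ⊣ φ'⊣ k n = φ'⊣ k (m ⊣ n);
  fs4c m j k : m ⊣ f⊣ j k + φ'⊣ (j ⊣ k) m = φ'⊣ k (φ'⊣ j m);
  fs4d i n p : φ⊣ i (n ⊣ p) = φ⊣ i n ⊣ p;
  fs4e i j p : φ⊣ i (φ⊣ j p) = φ⊣ (i ⊣ j) p + f⊣ i j ⊣ p;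
  fs4f i k n : φ⊣ i (φ'⊣ k n) = φ'⊣ k (φ⊣ i n);
  fs4g i j k : φ⊣ i (f⊣ j k) + f⊣ i (j ⊣ k) = φ'⊣ k (f⊣ i j) + f⊣ (i ⊣ j) k
}.

Record factor_axioms5 : Prop := FactorAxioms5 {
  fs5a m j p : m ⊢ φ⊢ j p = φ'⊢ j m ⊢ p;
  fs5b m k n : m ⊢ φ'⊢ k n = φ'⊢ k (m ⊢ n);
  fs5c m j k : m ⊢ f⊢ j k + φ'⊢ (j ⊢ k) m = φ'⊢ k (φ'⊢ j m);
  fs5d i n p : φ⊢ i (n ⊢ p) = φ⊢ i n ⊢ p;
  fs5e i j p : φ⊢ i (φ⊢ j p) = φ⊢ (i ⊢ j) p + f⊢ i j ⊢ p;
  fs5f i k n : φ⊢ i (φ'⊢ k n) = φ'⊢ k (φ⊢ i n);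
  fs5g i j k : φ⊢ i (f⊢ j k) + f⊢ i (j ⊢ k) = φ'⊢ k (f⊢ i j) + f⊢ (i ⊢ j) k
}.

End FactorAxioms.

Record factor_system (F : fieldType) (A B : diassType F) := FactorSystem {
  fs_data :> factor_data A B;
  fs_axioms1 : factor_axioms1 fs_data;
  fs_axioms2 : factor_axioms2 fs_data;
  fs_axioms3 : factor_axioms3 fs_data;
  fs_axioms4 : factor_axioms4 fs_data;
  fs_axioms5 : factor_axioms5 fs_data
}.

Definition fs_equiv (F : fieldType) (A B : diassType F)
    (phi psi : factor_system A B) : Prop :=
  exists E : {linear B -> A},
    [/\ forall i m, phi_dashv psi i m = phi_dashv phi i m + E i ⊣ m,
        forall i m, phi_vdash psi i m = phi_vdash phi i m + E i ⊢ m,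
        forall i m, phi'_dashv psi i m = phi'_dashv phi i m + m ⊣ E i
      & forall i m, phi'_vdash psi i m = phi'_vdash phi i m + m ⊢ E i] /\
    [/\ forall i j, f_dashv psi i j =
          f_dashv phi i j + phi'_dashv phi j (E i) + phi_dashv phi i (E j)
          + E i ⊣ E j - E (i ⊣ j)
      & forall i j, f_vdash psi i j =
          f_vdash phi i j + phi'_vdash phi j (E i) + phi_vdash phi i (E j)
          + E i ⊢ E j - E (i ⊢ j)].

Record extension (F : fieldType) (A B : diassType F) := Extension {
  ext_mid : diassType F;
  ext_sigma : {linear A -> ext_mid};
  ext_pi : {linear ext_mid -> B};
  ext_sigma_hom : diass_hom ext_sigma;
  ext_pi_hom : diass_hom ext_pi;
  ext_sigma_inj : injective ext_sigma;
  ext_pi_surj : forall b, exists x, ext_pi x = b;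
  ext_exact : forall x, ext_pi x = 0 <-> exists m, ext_sigma m = x
}.

Section ExtensionMaps.
Variables (F : fieldType) (A B : diassType F) (X : extension A B).

Local Notation L := (ext_mid X).
Local Notation σ := (ext_sigma X).
Local Notation π := (ext_pi X).

Implicit Types (x y : L) (m : A).

Fact sigma_preim y : π y = 0 -> exists m, σ m == y.
Proof. by move=> /ext_exact [m <-]; exists m. Qed.

Definition sigma_inv y (y0 : π y = 0) : A := xchoose (sigma_preim y0).

Lemma sigma_invK y (y0 : π y = 0) : σ (sigma_inv y0) = y.
Proof. exact/eqP/(xchooseP (sigma_preim y0)). Qed.

Lemma sigmaK m (y0 : π (σ m) = 0) : sigma_inv y0 = m.
Proof. by apply: (@ext_sigma_inj _ _ _ X); rewrite sigma_invK. Qed.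

Fact pi_sigma m : π (σ m) = 0.
Proof. by apply/ext_exact; exists m. Qed.

Fact pi_dashv_sigmar x m : π (x ⊣ σ m) = 0.
Proof. by rewrite (ext_pi_hom X).1 pi_sigma linear0r. Qed.

Fact pi_dashv_sigmal x m : π (σ m ⊣ x) = 0.
Proof. by rewrite (ext_pi_hom X).1 pi_sigma linear0l. Qed.

Fact pi_vdash_sigmar x m : π (x ⊢ σ m) = 0.
Proof. by rewrite (ext_pi_hom X).2 pi_sigma linear0r. Qed.

Fact pi_vdash_sigmal x m : π (σ m ⊢ x) = 0.
Proof. by rewrite (ext_pi_hom X).2 pi_sigma linear0l. Qed.

Definition P_dashv x m : A := sigma_inv (pi_dashv_sigmar x m).
Definition P'_dashv x m : A := sigma_inv (pi_dashv_sigmal x m).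
Definition P_vdash x m : A := sigma_inv (pi_vdash_sigmar x m).
Definition P'_vdash x m : A := sigma_inv (pi_vdash_sigmal x m).

Definition is_section (T : {linear B -> L}) : Prop := forall i, π (T i) = i.

Definition ext_splits : Prop :=
  exists T : {linear B -> L}, is_section T /\ diass_hom T.

Definition belongs_to (phi : factor_system A B) (T : {linear B -> L}) : Prop :=
  [/\ forall i m, phi_dashv phi i m = P_dashv (T i) m,
      forall i m, phi_vdash phi i m = P_vdash (T i) m,
      forall i m, phi'_dashv phi i m = P'_dashv (T i) m
    & forall i m, phi'_vdash phi i m = P'_vdash (T i) m] /\
  [/\ forall i j, σ (f_dashv phi i j) = T i ⊣ T j - T (i ⊣ j)
    & forall i j, σ (f_vdash phi i j) = T i ⊢ T j - T (i ⊢ j)].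

End ExtensionMaps.

(* The extension to which a factor system belongs exists and is unique up to
   equivalence, and splitting is invariant under equivalence of extensions, so
   the choice of the witness X is immaterial. *)
Definition fs_splits (F : fieldType) (A B : diassType F)
    (phi : factor_system A B) : Prop :=
  exists (X : extension A B) (T : {linear B -> ext_mid X}),
    [/\ is_section T, belongs_to phi T & ext_splits X].

(* Main.v *)
Require Import Defs.
From HB Require Import structures.
From mathcomp Require Import all_boot all_algebra.

Set Implicit Arguments.
Unset Strict Implicit.
Unset Printing Implicit Defensive.

(** The proof translates between factor systems and sections of extensions.

    Write a typical element of an extension as sigma m + T i.  Expanding the two
    products on such elements shows that an extension with a section is, up to
    equivalence, the space A * B with products built from the factor system.
    Each diassociative law is trilinear, so it may be tested on elements of A
    and of B; the eight resulting cases are the law in A and the seven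
    identities (a)-(g) of one group of factor system axioms, the case of three
    elements of B also using the law in B.  Read in one direction, this turns a
    factor system into an extension, the crossed product
    ([crossed_extension_belongs]); read in the other, it turns a section of an
    extension into a factor system ([section_factor_system_belongs]).

    Two sections of one extension differ by sigma o E with E : B -> A linear,
    and substituting S = T + sigma o E in the definition of the factor system of
    S gives exactly the formulas of equivalence ([belongs_equiv]).  The
    cocycle g of S measures the failure of S to be a homomorphism.  So a
    splitting S yields an equivalent factor system with g = 0, which is (b);
    the formula for g with g = 0 is the system of equations (c) for E; and given
    a solution E of these equations, i |-> (E i, i) is a splitting of the
    crossed product ([graph_map_hom]). *)

Import GRing.Theory.
Local Open Scope ring_scope.

(** * Identities between triadditive maps on a direct sum *)

Section TriadditiveMaps.
Variables (F : fieldType) (A B : lmodType F).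
Local Notation L := (A * B)%type.

Definition summand (s : A + B) : L :=
  match s with inl m => (m, 0) | inr i => (0, i) end.

Lemma additive_ext (u v : L -> L) :
    {morph u : x y / x + y} -> {morph v : x y / x + y} ->
    (forall s, u (summand s) = v (summand s)) ->
  u =1 v.
Proof.
move=> uD vD uv [m i]; have -> : (m, i) = (m, 0) + (0, i) :> L.
  by rewrite -[RHS]/(m + 0, 0 + i) addr0 add0r.
by rewrite uD vD (uv (inl m)) (uv (inr i)).
Qed.

Definition triadditive (u : L -> L -> L -> L) : Prop :=
  [/\ forall y z, {morph (fun x => u x y z) : x x' / x + x'},
      forall x z, {morph (fun y => u x y z) : y y' / y + y'}
    & forall x y, {morph (fun z => u x y z) : z z' / z + z'}].

(** This is what makes each law of the crossed product split into one law of A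
    and seven factor system identities, instead of one equation between sums
    of many terms. *)
Lemma triadditive_ext (u v : L -> L -> L -> L) :
    triadditive u -> triadditive v ->
    (forall s t r, u (summand s) (summand t) (summand r)
                 = v (summand s) (summand t) (summand r)) ->
  forall x y z, u x y z = v x y z.
Proof.
move=> [uDx uDy uDz] [vDx vDy vDz] uv x y z; move: x.
apply: additive_ext => // s; move: y.
apply: additive_ext => // t; move: z.
exact: additive_ext.
Qed.

Lemma triadditive_nestl (p q : {bilinear L -> L -> L}) :
  triadditive (fun x y z => p (q x y) z).
Proof. by split=> *; move=> ? ?; rewrite ?(linearDl, linearDr). Qed.

Lemma triadditive_nestr (p q : {bilinear L -> L -> L}) :
  triadditive (fun x y z => p x (q y z)).
Proof. by split=> *; move=> ? ?; rewrite ?(linearDl, linearDr). Qed.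

End TriadditiveMaps.

(** * Bilinear products on a direct sum *)

Section TwistedProduct.
Variables (F : fieldType) (A B : lmodType F).
Variables (mulA : {bilinear A -> A -> A}) (mulB : {bilinear B -> B -> B}).
Variables (phi phi' : {bilinear B -> A -> A}) (f : {bilinear B -> B -> A}).
Local Notation L := (A * B)%type.

(** The product on A * B for which (m, i) stands for sigma m + T i in an
    extension with a section T.  The two products of the extension have the same
    shape, so both are instances of this one. *)
Definition twisted_mul (x y : L) : L :=
  (mulA x.1 y.1 + phi x.2 y.1 + phi' y.2 x.1 + f x.2 y.2, mulB x.2 y.2).

Lemma twisted_mul_bilinear : bilinear_for *:%R *:%R twisted_mul.
Proof.
split=> [y|y] a x z; rewrite /twisted_mul /=; congr (_, _);
  rewrite ?(linearPl, linearPr) //= !scalerDr;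
  (* interleave the four pairs of terms of the left-hand side *)
  by rewrite [LHS](AC (2 * 2 * 2 * 2) ((1 * 3 * 5 * 7) * (2 * 4 * 6 * 8))).
Qed.

HB.instance Definition _ := bilinear_isBilinear.Build F L L L *:%R *:%R
  twisted_mul twisted_mul_bilinear.

Lemma twisted_mulAx m y : twisted_mul (m, 0) y = (mulA m y.1 + phi' y.2 m, 0).
Proof. by rewrite /twisted_mul /= !(linear0l, linear0r) !addr0. Qed.

Lemma twisted_mulxA x n : twisted_mul x (n, 0) = (mulA x.1 n + phi x.2 n, 0).
Proof. by rewrite /twisted_mul /= !(linear0l, linear0r) !addr0. Qed.

Lemma twisted_mulBx i y :
  twisted_mul (0, i) y = (phi i y.1 + f i y.2, mulB i y.2).
Proof. by rewrite /twisted_mul /= !(linear0l, linear0r) add0r addr0. Qed.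

Lemma twisted_mulxB x j :
  twisted_mul x (0, j) = (phi' j x.1 + f x.2 j, mulB x.2 j).
Proof. by rewrite /twisted_mul /= !(linear0l, linear0r) !add0r. Qed.

Definition twisted_mulE :=
  (twisted_mulAx, twisted_mulxA, twisted_mulBx, twisted_mulxB).

End TwistedProduct.

(** * The crossed product extension *)

(** Indexed by the factor system, so that each one gives its own pair of
    products on A * B. *)
Definition crossed_product (F : fieldType) (A B : diassType F)
  of factor_system A B : Type := (A * B)%type.

Section CrossedProduct.
Variables (F : fieldType) (A B : diassType F) (phi : factor_system A B).
Local Notation L := (crossed_product phi).

HB.instance Definition _ := GRing.Lmodule.copy L (A * B)%type.

Definition dashv_crossed : L -> L -> L :=
  twisted_mul dashv dashv (phi_dashv phi) (phi'_dashv phi) (f_dashv phi).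
Definition vdash_crossed : L -> L -> L :=
  twisted_mul vdash vdash (phi_vdash phi) (phi'_vdash phi) (f_vdash phi).

(** The pattern of the next five lemmas: each case on summands is either the law
    in A or B or one of the identities (a)-(g) of a single group of axioms, up
    to the order of two terms. *)
Lemma dashv_crossedA : associative dashv_crossed.
Proof.
apply: triadditive_ext; [exact: triadditive_nestr | exact: triadditive_nestl |].
case: (fs_axioms4 phi) => a b c d e f g.
move=> [m|i] [n|j] [p|k] /=; rewrite /dashv_crossed /vdash_crossed;
  rewrite !twisted_mulE /= ?(linear0l, linear0r, addr0, add0r); congr (_, _);
  first [by [] | exact: dashvA | exact: a | exact: b | exact: c | exact: d
        | exact: e | exact: f | exact: g | by rewrite addrC e].
Qed.

Lemma vdash_crossedA : associative vdash_crossed.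
Proof.
apply: triadditive_ext; [exact: triadditive_nestr | exact: triadditive_nestl |].
case: (fs_axioms5 phi) => a b c d e f g.
move=> [m|i] [n|j] [p|k] /=; rewrite /dashv_crossed /vdash_crossed;
  rewrite !twisted_mulE /= ?(linear0l, linear0r, addr0, add0r); congr (_, _);
  first [by [] | exact: vdashA | exact: a | exact: b | exact: c | exact: d
        | exact: e | exact: f | exact: g | by rewrite addrC e].
Qed.

Lemma crossed_diassD1 x y z :
  dashv_crossed x (dashv_crossed y z)
  = dashv_crossed x (vdash_crossed y z).
Proof.
move: x y z; apply: triadditive_ext;
  [exact: triadditive_nestr | exact: triadditive_nestr |].
case: (fs_axioms1 phi) => a b c d e f g.
move=> [m|i] [n|j] [p|k] /=; rewrite /dashv_crossed /vdash_crossed;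
  rewrite !twisted_mulE /= ?(linear0l, linear0r, addr0, add0r); congr (_, _);
  first [by [] | exact: diassD1 | exact: a | exact: b | exact: c | exact: d
        | exact: e | exact: f | exact: g].
Qed.

Lemma crossed_diassD2 x y z :
  dashv_crossed (vdash_crossed x y) z
  = vdash_crossed x (dashv_crossed y z).
Proof.
move: x y z; apply: triadditive_ext;
  [exact: triadditive_nestl | exact: triadditive_nestr |].
case: (fs_axioms2 phi) => a b c d e f g.
move=> [m|i] [n|j] [p|k] /=; rewrite /dashv_crossed /vdash_crossed;
  rewrite !twisted_mulE /= ?(linear0l, linear0r, addr0, add0r); congr (_, _);
  first [by [] | exact: diassD2 | exact: a | exact: b | exact: c | exact: d
        | exact: e | exact: f | exact: g
        | by rewrite addrC f].
Qed.

Lemma crossed_diassD3 x y z :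
  vdash_crossed (dashv_crossed x y) z
  = vdash_crossed (vdash_crossed x y) z.
Proof.
move: x y z; apply: triadditive_ext;
  [exact: triadditive_nestl | exact: triadditive_nestl |].
case: (fs_axioms3 phi) => a b c d e f g.
move=> [m|i] [n|j] [p|k] /=; rewrite /dashv_crossed /vdash_crossed;
  rewrite !twisted_mulE /= ?(linear0l, linear0r, addr0, add0r); congr (_, _);
  first [by [] | exact: diassD3 | exact: a | exact: b | exact: c | exact: d
        | exact: e | exact: f | exact: g].
Qed.

HB.instance Definition _ :=
  Lmodule_isDiassociative.Build F L
    (twisted_mul_bilinear _ _ _ _ _) (twisted_mul_bilinear _ _ _ _ _)
    dashv_crossedA vdash_crossedA
    crossed_diassD1 crossed_diassD2 crossed_diassD3.

Definition crossed_sigma (m : A) : L := (m, 0).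
Definition crossed_pi (x : L) : B := x.2.

Fact crossed_sigma_linear : linear crossed_sigma.
Proof.
by move=> a m n; rewrite -[RHS]/(a *: m + n, a *: 0 + 0) scaler0 addr0.
Qed.
HB.instance Definition _ :=
  GRing.isLinear.Build F A L *:%R crossed_sigma crossed_sigma_linear.

Fact crossed_pi_linear : linear crossed_pi.
Proof. by []. Qed.
HB.instance Definition _ :=
  GRing.isLinear.Build F L B *:%R crossed_pi crossed_pi_linear.

Lemma crossed_sigma_hom : diass_hom crossed_sigma.
Proof.
by split=> m n; rewrite [RHS]twisted_mulAx /= linear0l addr0.
Qed.

Lemma crossed_exact x : crossed_pi x = 0 <-> exists m, crossed_sigma m = x.
Proof.
by split=> [|[m <-] //]; case: x => m i /= ->; exists m.
Qed.

Definition crossed_extension : extension A B :=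
  @Extension F A B L crossed_sigma crossed_pi crossed_sigma_hom
    (conj (fun _ _ => erefl) (fun _ _ => erefl))
    (fun m n eq_mn => congr1 fst eq_mn)
    (fun i => ex_intro _ (0, i) erefl) crossed_exact.

(** The sections of the crossed product are exactly the graphs of linear maps
    E : B -> A; the graph of 0 is the section to which phi belongs. *)
Definition graph_map (E : B -> A) (i : B) : L := (E i, i).

Fact graph_map_linear (E : {linear B -> A}) : linear (graph_map E).
Proof. by move=> a i j; congr (_, _); rewrite linearP. Qed.
HB.instance Definition _ (E : {linear B -> A}) :=
  GRing.isLinear.Build F B L *:%R (graph_map E) (graph_map_linear E).

Lemma graph_map_section (E : {linear B -> A}) :
  @is_section F A B crossed_extension (graph_map E).
Proof. by []. Qed.

Lemma crossed_extension_belongs :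
  @belongs_to F A B crossed_extension phi (graph_map (\0 : {linear B -> A})).
Proof.
split; split=> i x.
1-4: apply: (@ext_sigma_inj F A B crossed_extension); rewrite sigma_invK.
1-4: rewrite [RHS]twisted_mulE /= ?(linear0l, linear0r, addr0, add0r) //.
(* (0, i) * (0, j) = (f i j, 0) + (0, i * j) for both products *)
all: apply/esym/eqP; rewrite subr_eq; apply/eqP; rewrite [LHS]twisted_mulE /=.
all: by rewrite linear0r add0r -[RHS]/(_ + 0, 0 + _) addr0 add0r.
Qed.

(** The A-component of the product of (E i, i) and (E j, j) is
    E i * E j + phi i (E j) + phi' j (E i) + f i j, and the hypotheses
    solve for f the condition that this be E (i * j). *)
Lemma graph_map_hom (E : {linear B -> A}) :
    (forall i j, f_dashv phi i j =
       - phi'_dashv phi j (E i) - phi_dashv phi i (E j)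
       - E i ⊣ E j + E (i ⊣ j)) ->
    (forall i j, f_vdash phi i j =
       - phi'_vdash phi j (E i) - phi_vdash phi i (E j)
       - E i ⊢ E j + E (i ⊢ j)) ->
  diass_hom (graph_map E).
Proof.
move=> fE_dashv fE_vdash; split=> i j; apply/esym; congr (_, _).
  by rewrite /= fE_dashv !addrA !addrK subrr add0r.
by rewrite /= fE_vdash !addrA !addrK subrr add0r.
Qed.

End CrossedProduct.

(** * The factor system of a section *)

Section SectionFactorSystem.
Variables (F : fieldType) (A B : diassType F) (X : extension A B).
Variables (S : {linear B -> ext_mid X}) (S_section : is_section S).
Local Notation σ := (ext_sigma X).
Local Notation π := (ext_pi X).

Let σ_inj : injective σ := @ext_sigma_inj _ _ _ X.

Fact pi_dashv_defect i j : π (S i ⊣ S j - S (i ⊣ j)) = 0.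
Proof. by rewrite linearB (ext_pi_hom X).1 !S_section subrr. Qed.

Fact pi_vdash_defect i j : π (S i ⊢ S j - S (i ⊢ j)) = 0.
Proof. by rewrite linearB (ext_pi_hom X).2 !S_section subrr. Qed.

Definition act_dashv i m := P_dashv (S i) m.
Definition act_vdash i m := P_vdash (S i) m.
Definition act'_dashv i m := P'_dashv (S i) m.
Definition act'_vdash i m := P'_vdash (S i) m.
Definition defect_dashv i j := sigma_inv (pi_dashv_defect i j).
Definition defect_vdash i j := sigma_inv (pi_vdash_defect i j).

Let act_dashvE i m : σ (act_dashv i m) = S i ⊣ σ m.
Proof. exact: sigma_invK. Qed.
Let act_vdashE i m : σ (act_vdash i m) = S i ⊢ σ m.
Proof. exact: sigma_invK. Qed.
Let act'_dashvE i m : σ (act'_dashv i m) = σ m ⊣ S i.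
Proof. exact: sigma_invK. Qed.
Let act'_vdashE i m : σ (act'_vdash i m) = σ m ⊢ S i.
Proof. exact: sigma_invK. Qed.
Let defect_dashvE i j : σ (defect_dashv i j) = S i ⊣ S j - S (i ⊣ j).
Proof. exact: sigma_invK. Qed.
Let defect_vdashE i j : σ (defect_vdash i j) = S i ⊢ S j - S (i ⊢ j).
Proof. exact: sigma_invK. Qed.
Let σE := (act_dashvE, act_vdashE, act'_dashvE, act'_vdashE,
           defect_dashvE, defect_vdashE, (ext_sigma_hom X).1,
           (ext_sigma_hom X).2).

Fact act_dashv_bilinear : bilinear_for *:%R *:%R act_dashv.
Proof.
by split=> u a x y; apply: σ_inj;
  rewrite linearP !σE linearP (linearPl, linearPr).
Qed.
HB.instance Definition _ := bilinear_isBilinear.Build F B A A *:%R *:%R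
  act_dashv act_dashv_bilinear.

Fact act_vdash_bilinear : bilinear_for *:%R *:%R act_vdash.
Proof.
by split=> u a x y; apply: σ_inj;
  rewrite linearP !σE linearP (linearPl, linearPr).
Qed.
HB.instance Definition _ := bilinear_isBilinear.Build F B A A *:%R *:%R
  act_vdash act_vdash_bilinear.

Fact act'_dashv_bilinear : bilinear_for *:%R *:%R act'_dashv.
Proof.
by split=> u a x y; apply: σ_inj;
  rewrite linearP !σE linearP (linearPl, linearPr).
Qed.
HB.instance Definition _ := bilinear_isBilinear.Build F B A A *:%R *:%R
  act'_dashv act'_dashv_bilinear.

Fact act'_vdash_bilinear : bilinear_for *:%R *:%R act'_vdash.
Proof.
by split=> u a x y; apply: σ_inj;
  rewrite linearP !σE linearP (linearPl, linearPr).
Qed.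
HB.instance Definition _ := bilinear_isBilinear.Build F B A A *:%R *:%R
  act'_vdash act'_vdash_bilinear.

Fact defect_dashv_bilinear : bilinear_for *:%R *:%R defect_dashv.
Proof.
split=> u a x y; apply: σ_inj; rewrite linearP !σE linearP.
all: rewrite !(linearPl, linearPr) linearP.
all: by rewrite /= scalerBr opprD addrACA.
Qed.
HB.instance Definition _ := bilinear_isBilinear.Build F B B A *:%R *:%R
  defect_dashv defect_dashv_bilinear.

Fact defect_vdash_bilinear : bilinear_for *:%R *:%R defect_vdash.
Proof.
split=> u a x y; apply: σ_inj; rewrite linearP !σE linearP.
all: rewrite !(linearPl, linearPr) linearP.
all: by rewrite /= scalerBr opprD addrACA.
Qed.
HB.instance Definition _ := bilinear_isBilinear.Build F B B A *:%R *:%R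
  defect_vdash defect_vdash_bilinear.

(** The axioms hold because sigma is injective and turns each side of a factor
    system identity into a product of three elements of the forms sigma m and
    S i, up to a term S of a product in B: the mixed terms cancel, and
    what is left is an instance of one law in the middle algebra, together with
    the same law in B when all three elements are of the form S i. *)
Definition section_data : factor_data A B :=
  FactorData act_dashv act_vdash act'_dashv act'_vdash
    defect_dashv defect_vdash.

Fact section_axioms1 : factor_axioms1 section_data.
Proof.
split=> * /=; apply: σ_inj;
  rewrite /= ?[σ (_ + _)]linearD !σE ?(linearBl, linearBr) /=.
all: rewrite ?subrKC ?addrA ?subrK.
all: by rewrite ?diassD1.
Qed.

Fact section_axioms2 : factor_axioms2 section_data.
Proof.
split=> * /=; apply: σ_inj;
  rewrite /= ?[σ (_ + _)]linearD !σE ?(linearBl, linearBr) /=.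
all: rewrite ?subrKC ?addrA ?subrK.
all: by rewrite ?diassD2.
Qed.

Fact section_axioms3 : factor_axioms3 section_data.
Proof.
split=> * /=; apply: σ_inj;
  rewrite /= ?[σ (_ + _)]linearD !σE ?(linearBl, linearBr) /=.
all: rewrite ?subrKC ?addrA ?subrK.
all: by rewrite ?diassD3.
Qed.

Fact section_axioms4 : factor_axioms4 section_data.
Proof.
split=> * /=; apply: σ_inj;
  rewrite /= ?[σ (_ + _)]linearD !σE ?(linearBl, linearBr) /=.
all: rewrite ?subrKC ?addrA ?subrK.
all: by rewrite ?dashvA.
Qed.

Fact section_axioms5 : factor_axioms5 section_data.
Proof.
split=> * /=; apply: σ_inj;
  rewrite /= ?[σ (_ + _)]linearD !σE ?(linearBl, linearBr) /=.
all: rewrite ?subrKC ?addrA ?subrK.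
all: by rewrite ?vdashA.
Qed.

Definition section_factor_system : factor_system A B :=
  FactorSystem section_axioms1 section_axioms2 section_axioms3
    section_axioms4 section_axioms5.

Lemma section_factor_system_belongs : belongs_to section_factor_system S.
Proof. by split; split=> i x //; rewrite σE. Qed.

End SectionFactorSystem.

(** * Change of section *)

Section TwoSections.
Variables (F : fieldType) (A B : diassType F) (X : extension A B).
Variables (S T : {linear B -> ext_mid X}).
Variables (S_section : is_section S) (T_section : is_section T).
Local Notation σ := (ext_sigma X).
Local Notation π := (ext_pi X).

Let σ_inj : injective σ := @ext_sigma_inj _ _ _ X.

Fact pi_section_sub i : π (S i - T i) = 0.
Proof. by rewrite linearB S_section T_section subrr. Qed.

Definition section_sub i : A := sigma_inv (pi_section_sub i).

Fact section_sub_linear : linear section_sub.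
Proof.
move=> a i j; apply: σ_inj; rewrite linearP !sigma_invK !linearP /=.
by rewrite !scalerDr addrACA.
Qed.
HB.instance Definition _ :=
  GRing.isLinear.Build F B A *:%R section_sub section_sub_linear.

Lemma sections_differ :
  exists E : {linear B -> A}, forall i, S i = T i + σ (E i).
Proof. by exists section_sub => i; rewrite sigma_invK subrKC. Qed.

(** The equivalence is witnessed by E = sigma^-1 (S - T): substituting
    S = T + sigma E in the products of S i with sigma m and with S j and
    expanding gives the defining formulas of equivalence. *)
Lemma belongs_equiv (phi psi : factor_system A B) :
  belongs_to phi T -> belongs_to psi S -> fs_equiv phi psi.
Proof.
move=> [[phi1 phi2 phi3 phi4] [f1 f2]] [[psi1 psi2 psi3 psi4] [g1 g2]].
have [E SE] := sections_differ.
exists E; split; split=> i x; apply: σ_inj.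
- by rewrite linearD (ext_sigma_hom X).1 phi1 psi1 !sigma_invK SE linearDl.
- by rewrite linearD (ext_sigma_hom X).2 phi2 psi2 !sigma_invK SE linearDl.
- by rewrite linearD (ext_sigma_hom X).1 phi3 psi3 !sigma_invK SE linearDr.
- by rewrite linearD (ext_sigma_hom X).2 phi4 psi4 !sigma_invK SE linearDr.
- rewrite linearB !linearD (ext_sigma_hom X).1 /= f1 g1 phi1 phi3 !sigma_invK.
  rewrite !SE !(linearDl, linearDr) opprD.
  by rewrite [LHS](AC (2 * 2 * 2) (1 * 5 * 3 * 2 * 4 * 6)).
- rewrite linearB !linearD (ext_sigma_hom X).2 /= f2 g2 phi2 phi4 !sigma_invK.
  rewrite !SE !(linearDl, linearDr) opprD.
  by rewrite [LHS](AC (2 * 2 * 2) (1 * 5 * 3 * 2 * 4 * 6)).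
Qed.

End TwoSections.

(** * Splitting criteria *)

Theorem theorem4p7 (F : fieldType) (A B : diassType F)
    (phi : factor_system A B) :
  [<-> fs_splits phi;
       exists psi : factor_system A B,
         [/\ fs_equiv phi psi,
             forall i j, f_dashv psi i j = 0
           & forall i j, f_vdash psi i j = 0];
       exists E : {linear B -> A}, forall i j : B,
         f_dashv phi i j =
           - phi'_dashv phi j (E i) - phi_dashv phi i (E j)
           - E i ⊣ E j + E (i ⊣ j) /\
         f_vdash phi i j =
           - phi'_vdash phi j (E i) - phi_vdash phi i (E j)
           - E i ⊢ E j + E (i ⊢ j)].
Proof.
tfae.
- move=> [X [T [T_section phiT [S [S_section [S_dashv S_vdash]]]]]].
  have psiS := section_factor_system_belongs S_section.
  exists (section_factor_system S_section); split.
  + exact: (belongs_equiv S_section T_section phiT psiS).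
  + move=> i j; apply: (@ext_sigma_inj F A B X).
    by rewrite psiS.2.1 S_dashv subrr linear0.
  + move=> i j; apply: (@ext_sigma_inj F A B X).
    by rewrite psiS.2.2 S_vdash subrr linear0.
- (* g = 0, read in the formula expressing g by f and E *)
  move=> [psi [[E [_ [g_dashv g_vdash]]] g_dashv0 g_vdash0]].
  exists E => i j; split; apply/eqP; rewrite -subr_eq0 !opprD !opprK !addrA.
    by rewrite -g_dashv g_dashv0.
  by rewrite -g_vdash g_vdash0.
- move=> [E fE]; exists (crossed_extension phi).
  exists (graph_map phi (\0 : {linear B -> A})); split.
  + exact: graph_map_section.
  + exact: crossed_extension_belongs.
  + exists (graph_map phi E); split; first exact: graph_map_section.
    by apply: graph_map_hom => i j; have [] := fE i j.
Qed.
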